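(* Let $\mathcal{H}$ be a finite-dimensional complex Hilbert space, let $\rho$ be a density operator on $\mathcal{H}$ (positive semi-definite with $\operatorname{Tr}\rho=1$) and let $\sigma$ be a positive semi-definite operator on $\mathcal{H}$ with $\ker\sigma\subseteq\ker\rho$. Suppose $J$ is an open interval containing $1$, and $g:J\to\mathbb{R}$ is a continuously differentiable function with $g(1)\neq 0$. Then $$\lim_{\alpha\to 1} D_{\alpha,g(\alpha)}(\rho\|\sigma)=D(\rho\|\sigma)=\operatorname{Tr}\big(\rho(\log\rho-\log\sigma)\big).$$
   Context: For $\alpha\in\mathbb{R}\setminus\{1\}$ and $z\in\mathbb{R}\setminus\{0\}$, the $\alpha$-$z$ relative Rényi entropy is $$D_{\alpha,z}(\rho\|\sigma):=\frac{1}{\alpha-1}\log\operatorname{Tr}\Big(\big(\sigma^{\frac{1-\alpha}{2z}}\rho^{\frac{\alpha}{z}}\sigma^{\frac{1-\alpha}{2z}}\big)^z\Big).$$ Real powers (including negative ones) and logarithms of positive semi-definite operators are evaluated on their support (i.e. via the spectral decomposition restricted to nonzero eigenvalues, so e.g. $\rho^{-1}$ is the generalized inverse and $\log\rho$ is the logarithm on the support of $\rho$). $\log$ denotes the natural logarithm. *)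

(* Defs.v *)
From HB Require Import structures.
From mathcomp Require Import all_boot all_order all_algebra.
From mathcomp Require Import sesquilinear spectral.
From mathcomp Require Import complex.
From mathcomp Require Import all_classical all_reals.
From mathcomp Require Import topology normedtype derive exp.

Set Implicit Arguments.
Unset Strict Implicit.
Unset Printing Implicit Defensive.

Import Order.TTheory GRing.Theory Num.Theory numFieldNormedType.Exports.
Local Open Scope ring_scope.
Local Open Scope complex_scope.

Section QDefs.
Variable R : realType.
Local Notation C := R[i].

Definition adjmx m n (A : 'M[C]_(m, n)) : 'M[C]_(n, m) := (map_mx (@Num.conj _) A)^T.

Definition psdmx n (A : 'M[C]_n) : Prop :=
  A \is hermsymmx /\ forall v : 'cV[C]_n, 0 <= (adjmx v *m A *m v) 0 0.

Definition densitymx n (A : 'M[C]_n) : Prop := psdmx A /\ \tr A = 1.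

Definition ker_sub n (A B : 'M[C]_n) : Prop :=
  forall v : 'cV[C]_n, A *m v = 0 -> B *m v = 0.

(* Functional calculus for (normal / Hermitian) matrices, evaluated on the
   support: A = P^-1 diag(d) P (spectral theorem, P unitary), and
   f[A] = P^-1 diag(f'(d)) P with f'(0) = 0 and f'(λ) = f (Re λ) for λ <> 0. *)
Definition supp_fun n (f : R -> R) (A : 'M[C]_n) : 'M[C]_n :=
  let P := spectralmx A in
  let d := spectral_diag A in
  invmx P *m
  diag_mx (\row_i (if d 0 i == 0 then 0 else (f (complex.Re (d 0 i)))%:C)) *m P.

Definition mxpow n (A : 'M[C]_n) (r : R) : 'M[C]_n := supp_fun (fun x => powR x r) A.
Definition mxlog n (A : 'M[C]_n) : 'M[C]_n := supp_fun (@ln R) A.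

Definition Daz n (rho sigma : 'M[C]_n) (a z : R) : R :=
  let s := mxpow sigma ((1 - a) / (2 * z)) in
  ln (complex.Re (\tr (mxpow (s *m mxpow rho (a / z) *m s) z))) / (a - 1).

Definition Drel n (rho sigma : 'M[C]_n) : R :=
  complex.Re (\tr (rho *m (mxlog rho - mxlog sigma))).

End QDefs.

(* Main.v *)
(** Put [w := 1 / z] and [e := (1 - a) / (2 z)].  The operator in [D_{a,z}] is
    [B := sigma^e rho^(w - 2 e) sigma^e], and [(rho^w)^z = rho].  Near [a = 1]
    the nonzero eigenvalues of [B] and [rho^w] stay in a fixed compact subset of
    the positive half-line, so a quadratic version of Klein's inequality, which
    needs no perturbation theory, gives
      [|Tr B^z - Tr rho - z Tr ((B - rho^w) rho^(1 - w))| <= C Tr ((B - rho^w)^2)].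
    The traces on both sides are combinations of
      [Tr (rho^p sigma^q rho^p' sigma^q')],
    which, expanded over the two eigenbases, is a finite real combination of
    exponentials of the exponents.  To first order in [e] the linear term gives
    the relative entropy and the quadratic term vanishes. *)
Require Import Defs.
From HB Require Import structures.
From mathcomp Require Import all_boot all_order all_algebra.
From mathcomp Require Import sesquilinear spectral.
From mathcomp Require Import complex.
From mathcomp Require Import all_classical all_reals.
From mathcomp Require Import topology normedtype derive exp.
From mathcomp Require Import sequences ring lra.

Import Order.TTheory GRing.Theory Num.Theory numFieldNormedType.Exports.
Local Open Scope ring_scope.
Local Open Scope classical_set_scope.

Set Implicit Arguments.
Unset Strict Implicit.
Unset Printing Implicit Defensive.

(** The eigenvalue list [x] is independent of the basis [P], so functional calculus in one basis
    becomes pointwise arithmetic on real functions. Locking keeps the matrix product from being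
    unfolded by rewriting. *)
HB.lock Definition spd (R : realType) n (P : 'M[R[i]]_n) (x : 'I_n -> R) :
    'M[R[i]]_n :=
  invmx P *m diag_mx (\row_i (x i)%:C%C) *m P.

(** * Spectral sums, real traces and Klein's inequality *)

Section SpectralCalculus.
Variables (R : realType) (n : nat).
Local Notation C := R[i].
Implicit Types (A B P Q : 'M[C]_n) (x y : 'I_n -> R).

Lemma adjmxM m p q (A : 'M[C]_(m, p)) (B : 'M[C]_(p, q)) :
  adjmx (A *m B) = adjmx B *m adjmx A.
Proof. by rewrite /adjmx map_mxM trmx_mul. Qed.

Lemma adjmxK m p (A : 'M[C]_(m, p)) : adjmx (adjmx A) = A.
Proof. by apply/matrixP => i j; rewrite !mxE conjCK. Qed.

Lemma hermsymmxE A : (A \is hermsymmx) = (A == adjmx A).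
Proof. by rewrite qualifE /= expr0 scale1r /adjmx map_trmx. Qed.

Lemma invmx_adj P : P \is unitarymx -> invmx P = adjmx P.
Proof. by move=> uP; rewrite invmx_unitary // /adjmx map_trmx. Qed.

Lemma eq_spd P x y : x =1 y -> spd P x = spd P y.
Proof.
by move=> /funext ->.
Qed.

Lemma spdM P x y : P \is unitarymx ->
  spd P x *m spd P y = spd P (fun i => x i * y i).
Proof.
move=> uP; have Pu := unitarymx_unit uP.
set D := fun z => diag_mx (\row_i (z i)%:C%C) : 'M[C]_n.
have -> : spd P (fun i => x i * y i) = invmx P *m (D x *m D y) *m P.
  rewrite unlock mulmx_diag (_ : (\row_i (x i * y i)%:C%C) =
    \row_i ((\row_i (x i)%:C%C) 0 i * (\row_i (y i)%:C%C) 0 i)) //.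
  by apply/rowP => i; rewrite !mxE rmorphM.
by rewrite unlock -/(D x) -/(D y) !mulmxA mulmxK.
Qed.

Lemma spd1 P : P \is unitarymx -> spd P (fun=> 1) = 1%:M.
Proof.
move=> uP; have Pu := unitarymx_unit uP.
rewrite unlock (_ : diag_mx _ = 1%:M) ?mulmx1 ?mulVmx //.
by rewrite -diag_const_mx; congr diag_mx; apply/rowP => i; rewrite !mxE.
Qed.

Lemma adj_spd P x : P \is unitarymx -> adjmx (spd P x) = spd P x.
Proof.
move=> uP; rewrite unlock invmx_adj // !adjmxM adjmxK mulmxA.
suff -> : adjmx (diag_mx (\row_i (x i)%:C%C)) = diag_mx (\row_i (x i)%:C%C) by [].
apply/matrixP => i j; rewrite !mxE.
rewrite rmorphMn /= eq_sym; case: eqVneq => [->|//].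
by rewrite !mulr1n; apply/CrealP/complex_realP; exists (x j).
Qed.

(** For unitary [P], [spd P (ind i)] is the i-th rank-one spectral projection. *)
Definition ind (i j : 'I_n) : R := (j == i)%:R.

Lemma spd_sum P x : spd P x = \sum_i (x i)%:C%C *: spd P (ind i).
Proof.
rewrite unlock; under eq_bigr do rewrite scalemxAl scalemxAr.
rewrite -mulmx_suml -mulmx_sumr; congr (mulmx (mulmx _ _) _).
apply/matrixP => k l; rewrite summxE !mxE (bigD1 k) //= big1 => [|i ik].
  by rewrite !mxE addr0 /ind eqxx mulrnAr mulr1.
by rewrite !mxE /ind eq_sym (negbTE ik) mul0rn mulr0.
Qed.

Lemma spdZ P x (k : R) : spd P (fun i => k * x i) = k%:C%C *: spd P x.
Proof.
rewrite spd_sum [in RHS]spd_sum scaler_sumr; apply: eq_bigr => i _.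
by rewrite scalerA rmorphM.
Qed.

(** Taking the real part preserves additivity, real homogeneity and cyclicity, and it places all
    limits in [R] although a trace of four factors need not be real. *)
Definition retr A : R := complex.Re (\tr A).

Lemma ReD (a b : C) : complex.Re (a + b) = complex.Re a + complex.Re b.
Proof. by case: a b => ? ? []. Qed.

Lemma ReB (a b : C) : complex.Re (a - b) = complex.Re a - complex.Re b.
Proof. by case: a b => ? ? []. Qed.

Lemma retrD A B : retr (A + B) = retr A + retr B.
Proof. by rewrite /retr raddfD ReD. Qed.

Lemma retrB A B : retr (A - B) = retr A - retr B.
Proof. by rewrite /retr raddfB ReB. Qed.

Lemma retr0 : retr 0 = 0. Proof. by rewrite /retr raddf0. Qed.

Lemma retrZ (a : R) A : retr (a%:C%C *: A) = a * retr A.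
Proof.
by rewrite /retr mxtraceZ; case: (\tr A) => u v /=; rewrite mul0r subr0.
Qed.

Lemma retrC A B : retr (A *m B) = retr (B *m A).
Proof. by rewrite /retr mxtrace_mulC. Qed.

Lemma retr_sum (I : finType) (F : I -> 'M[C]_n) :
  retr (\sum_i F i) = \sum_i retr (F i).
Proof. by rewrite (big_morph retr retrD retr0). Qed.

Lemma retr_mid P x A B :
  retr (A *m spd P x *m B) = \sum_i x i * retr (A *m spd P (ind i) *m B).
Proof.
rewrite {1}spd_sum mulmx_sumr mulmx_suml retr_sum.
by apply: eq_bigr => i _; rewrite -scalemxAr -scalemxAl retrZ.
Qed.

Lemma retr_spd P x : P \is unitarymx -> retr (spd P x) = \sum_i x i.
Proof.
move=> uP; have Pu := unitarymx_unit uP.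
rewrite /retr unlock mxtrace_mulC mulmxA mulmxV // mul1mx mxtrace_diag.
rewrite (big_morph (@complex.Re R) ReD erefl).
by apply: eq_bigr => i _; rewrite mxE.
Qed.

Lemma retr_adj_ge0 A : 0 <= retr (adjmx A *m A).
Proof.
have : 0 <= \tr (adjmx A *m A).
  rewrite /mxtrace sumr_ge0 // => i _; rewrite mxE sumr_ge0 // => j _.
  by rewrite !mxE mulrC mul_conjC_ge0.
by rewrite lecE => /andP[].
Qed.

Lemma ind_idem i : (fun j => ind i j * ind i j) = ind i.
Proof. by apply/funext => j; rewrite /ind; case: eqP; rewrite ?mulr1 ?mulr0. Qed.

(** The projection is idempotent and self-adjoint, so cyclicity turns the trace into the Gram trace
    of [A *m spd P (ind i)]. *)
Lemma retr_ind_ge0 P A i : P \is unitarymx ->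
  0 <= retr (A *m spd P (ind i) *m adjmx A).
Proof.
move=> uP; rewrite -[ind i]ind_idem -spdM // mulmxA -mulmxA retrC.
by rewrite -[X in retr (X *m _)]adjmxK adjmxM adjmxK adj_spd // retr_adj_ge0.
Qed.

(** For unitary [P] and [Q] this is the squared modulus of the inner product of the i-th and j-th
    eigenvectors. *)
Definition ovl P Q i j := retr (spd P (ind i) *m spd Q (ind j)).

Lemma ovl_ge0 P Q i j : P \is unitarymx -> Q \is unitarymx -> 0 <= ovl P Q i j.
Proof.
move=> uP uQ; rewrite /ovl -[ind i]ind_idem -spdM // -mulmxA retrC.
by rewrite -[X in _ *m X](adj_spd _ uP) retr_ind_ge0.
Qed.

Lemma retr_ovl P Q x y : retr (spd P x *m spd Q y) =
  \sum_i \sum_j x i * y j * ovl P Q i j.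
Proof.
rewrite -[spd P x]mul1mx retr_mid; apply: eq_bigr => i _.
rewrite mul1mx -[_ *m spd Q y]mulmx1 retr_mid mulr_sumr.
by apply: eq_bigr => j _; rewrite mulmx1 mulrA.
Qed.

Definition ovl4 P Q i j k l := retr (spd P (ind i) *m spd Q (ind j) *m
  spd P (ind k) *m spd Q (ind l)).

Lemma retr_ovl4 P Q x y x' y' :
  retr (spd P x *m spd Q y *m spd P x' *m spd Q y') =
  \sum_i \sum_j \sum_k \sum_l x i * y j * x' k * y' l * ovl4 P Q i j k l.
Proof.
have -> : spd P x *m spd Q y *m spd P x' *m spd Q y' =
    1%:M *m spd P x *m (spd Q y *m spd P x' *m spd Q y').
  by rewrite mul1mx !mulmxA.
rewrite retr_mid; apply: eq_bigr => i _; rewrite mul1mx.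
have -> : spd P (ind i) *m (spd Q y *m spd P x' *m spd Q y') =
    spd P (ind i) *m spd Q y *m (spd P x' *m spd Q y') by rewrite !mulmxA.
rewrite retr_mid mulr_sumr; apply: eq_bigr => j _; rewrite mulrA.
rewrite mulmxA retr_mid mulr_sumr; apply: eq_bigr => k _; rewrite mulrA.
rewrite -[_ *m spd Q y']mulmx1 retr_mid mulr_sumr.
by apply: eq_bigr => l _; rewrite mulrA mulmx1.
Qed.

(** Inserting the identity as [spd Q (fun=> 1)] writes a trace in one basis with the same weights as
    a mixed trace. *)
Lemma retr_ovl_l P Q x : Q \is unitarymx ->
  retr (spd P x) = \sum_i \sum_j x i * ovl P Q i j.
Proof.
move=> uQ; rewrite -(mulmx1 (spd P x)) -(spd1 uQ) retr_ovl.
by apply: eq_bigr => i _; apply: eq_bigr => j _; rewrite mulr1.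
Qed.

Lemma retr_ovl_r P Q y : P \is unitarymx ->
  retr (spd Q y) = \sum_i \sum_j y j * ovl P Q i j.
Proof.
move=> uP; rewrite -(mul1mx (spd Q y)) -(spd1 uP) retr_ovl.
by apply: eq_bigr => i _; apply: eq_bigr => j _; rewrite mul1r.
Qed.

(* Klein's inequality, with a quadratic instead of a one-sided bound. *)
Lemma klein P Q (a b f df : 'I_n -> R) (F : 'I_n -> R) (K : R) :
  P \is unitarymx -> Q \is unitarymx ->
  (forall i j, `|F j - f i - (b j - a i) * df i| <= K * (b j - a i) ^+ 2) ->
  `|retr (spd Q F) - retr (spd P f) -
     retr ((spd Q b - spd P a) *m spd P df)| <=
  K * retr ((spd Q b - spd P a) *m (spd Q b - spd P a)).
Proof.
move=> uP uQ H.
(* Both sides become double sums over the same nonnegative weights [ovl P Q i j], so the scalar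
   hypothesis can be applied term by term. *)
have e1 : retr (spd Q F) - retr (spd P f) -
     retr ((spd Q b - spd P a) *m spd P df) =
   \sum_i \sum_j (F j - f i - (b j - a i) * df i) * ovl P Q i j.
  rewrite mulmxBl retrB spdM // (retrC (spd Q b)) retr_ovl.
  rewrite (retr_ovl_r Q F uP) (retr_ovl_l P f uQ).
  rewrite (retr_ovl_l P (fun i => a i * df i) uQ).
  rewrite -2!sumrB -sumrB; apply: eq_bigr => i _.
  by rewrite -2!sumrB -sumrB; apply: eq_bigr => j _; ring.
have e2 : retr ((spd Q b - spd P a) *m (spd Q b - spd P a)) =
   \sum_i \sum_j (b j - a i) ^+ 2 * ovl P Q i j.
  rewrite mulmxBl 2!mulmxBr 3!retrB spdM // spdM // (retrC (spd Q b) (spd P a)).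
  rewrite (retr_ovl_r Q (fun i => b i * b i) uP).
  rewrite (retr_ovl_l P (fun i => a i * a i) uQ) retr_ovl.
  rewrite -2!sumrB -sumrB; apply: eq_bigr => i _.
  by rewrite -2!sumrB -sumrB; apply: eq_bigr => j _; ring.
rewrite e1 e2 mulr_sumr (le_trans (ler_norm_sum _ _ _)) // ler_sum // => i _.
rewrite mulr_sumr (le_trans (ler_norm_sum _ _ _)) // ler_sum // => j _.
have c0 := ovl_ge0 i j uP uQ.
by rewrite normrM (ger0_norm c0) mulrA ler_wpM2r.
Qed.

End SpectralCalculus.

(** * Eigenvalue bounds and powers on the support *)

Section Powers.
Variables (R : realType) (n : nat).
Local Notation C := R[i].
Implicit Types (A B P Q N K : 'M[C]_n) (x y : 'I_n -> R).

(** With [B := spd V b], [K] acts as [N B^-1] on the support of [B], so [K^* K] compresses to [B^-1]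
    there. Its trace therefore dominates the reciprocal of each nonzero eigenvalue. *)
Lemma gram_eigenvalue_bounds V (b : 'I_n -> R) N K : V \is unitarymx ->
  spd V b = adjmx N *m N -> K *m spd V b = N ->
  forall j, [/\ 0 <= b j, b j <= retr (adjmx N *m N) &
    b j != 0 -> 1 <= b j * retr (K *m adjmx K)].
Proof.
move=> uV BN KB.
have bN j : retr (N *m spd V (ind R j) *m adjmx N) = b j.
  rewrite retrC mulmxA -BN spdM // retr_spd // (bigD1 j) //= /ind eqxx mulr1.
  by rewrite big1 ?addr0 // => i /negbTE ->; rewrite mulr0.
have b0 j : 0 <= b j by rewrite -bN retr_ind_ge0.
move=> j; split => // [|bj0].
  by rewrite -BN retr_spd // (bigD1 j) //= lerDl sumr_ge0.
(* With [F] the j-th spectral projection of [B := spd V b], [K B = N] turns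
   [b_j^2 K F K^* = K B F B K^*] into [N F N^*], whose trace is [b_j]. *)
have key : b j * (b j * retr (K *m spd V (ind R j) *m adjmx K)) = b j.
  rewrite -[RHS]bN.
  have -> : retr (N *m spd V (ind R j) *m adjmx N) =
      retr (K *m (spd V b *m spd V (ind R j) *m spd V b) *m adjmx K).
    by rewrite -KB adjmxM adj_spd // !mulmxA.
  rewrite spdM // spdM //.
  have -> : (fun i => b i * ind R j i * b i) = (fun i => b j * (b j * ind R j i)).
    apply/funext => i; rewrite /ind; case: eqVneq => [->|_].
      by rewrite !mulr1.
    by rewrite !mulr0 mul0r.
  by rewrite !spdZ -!scalemxAr -!scalemxAl !retrZ.
have -> : 1 = b j * retr (K *m spd V (ind R j) *m adjmx K).
  by apply: (mulfI bj0); rewrite mulr1 key.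
rewrite ler_wpM2l //.
have <- : retr (K *m spd V (fun=> 1) *m adjmx K) = retr (K *m adjmx K).
  by rewrite spd1 // mulmx1.
rewrite [leRHS]retr_mid.
rewrite (bigD1 j) //= mul1r lerDl sumr_ge0 // => i _.
by rewrite mul1r retr_ind_ge0.
Qed.

Definition eigv A (i : 'I_n) : R := complex.Re (spectral_diag A 0 i).

Lemma eigvE A i : A \is hermsymmx -> spectral_diag A 0 i = (eigv A i)%:C%C.
Proof.
move=> hA; rewrite RRe_real //.
by have /mxOverP := hermitian_spectral_diag_real hA; apply.
Qed.

Lemma supp_funE f A : A \is hermsymmx -> supp_fun f A =
  spd (spectralmx A) (fun i => if eigv A i == 0 then 0 else f (eigv A i)).
Proof.
move=> hA; rewrite unlock /supp_fun.
suff -> : (\row_i (if spectral_diag A 0 i == 0 then 0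
             else (f (complex.Re (spectral_diag A 0 i)))%:C%C)) =
  \row_i (if eigv A i == 0 then 0 else f (eigv A i))%:C%C :> 'rV[C]_n by [].
apply/rowP => i; rewrite !mxE -/(eigv A i) eigvE //.
by rewrite (_ : 0 = 0%:C%C) // (inj_eq (@complexI R)); case: eqP.
Qed.

Lemma spd_eigv A : A \is hermsymmx -> spd (spectralmx A) (eigv A) = A.
Proof.
move=> hA; have /hermitian_normalmx /orthomx_spectralP hs := hA; rewrite [RHS]hs.
rewrite unlock; suff -> : \row_i (eigv A i)%:C%C = spectral_diag A by [].
by apply/rowP => i; rewrite !mxE -eigvE.
Qed.

(** The eigenvalue is the trace of the compression of [A] by its i-th spectral projection, and the
    diagonal entries of that compression are values of the quadratic form of [A]. *)
Lemma eigv_ge0 A i : psdmx A -> 0 <= eigv A i.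
Proof.
move=> [hA psdA]; set V := spectralmx A.
have uV : V \is unitarymx by exact: spectral_unitarymx.
have -> : eigv A i = retr (spd V (ind R i) *m A *m spd V (ind R i)).
  rewrite -[in RHS](spd_eigv hA) 2?spdM // retr_spd // (bigD1 i) //=.
  by rewrite /ind eqxx mul1r mulr1 big1 ?addr0 // => k /negbTE ->; rewrite mulr0.
have : 0 <= \tr (spd V (ind R i) *m A *m spd V (ind R i)).
  rewrite /mxtrace sumr_ge0 // => k _.
  have := psdA (col k (spd V (ind R i))).
  suff -> : adjmx (col k (spd V (ind R i))) = row k (spd V (ind R i)).
    by rewrite [col k _]colE mulmxA -!row_mul -colE !mxE.
  rewrite -[in RHS](adj_spd (ind R i) uV).
  by apply/rowP => l; rewrite !mxE.
by rewrite lecE => /andP[].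
Qed.

(* Unlike [powR], [pw 0 0 = 0]: powers are taken on the support. *)
Definition pw (r p : R) : R := if r == 0 then 0 else expR (p * ln r).

Lemma pwD r p q : pw r p * pw r q = pw r (p + q).
Proof.
by rewrite /pw; case: eqP => _; rewrite ?mulr0 // -expRD mulrDl.
Qed.

Lemma pw1 r : 0 <= r -> pw r 1 = r.
Proof.
rewrite /pw le_eqVlt; case: eqVneq => [->//|r0] /=.
by move=> rp; rewrite mul1r lnK.
Qed.

Lemma pwM r p q : pw (pw r p) q = pw r (p * q).
Proof.
rewrite /pw; case: (eqVneq r 0) => [_|_]; first by rewrite eqxx.
by rewrite expR_eq0 expRK mulrCA mulrA.
Qed.

Lemma mxpowE A p : A \is hermsymmx ->
  mxpow A p = spd (spectralmx A) (fun i => pw (eigv A i) p).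
Proof.
move=> hA; rewrite /mxpow supp_funE //; congr spd; apply/funext => i.
by rewrite /pw /powR; case: eqP.
Qed.

Lemma mxpowD A p q : A \is hermsymmx ->
  mxpow A p *m mxpow A q = mxpow A (p + q).
Proof.
move=> hA; rewrite !mxpowE // spdM ?spectral_unitarymx //.
by apply: eq_spd => i; rewrite pwD.
Qed.

Lemma mxpow1 A : psdmx A -> mxpow A 1 = A.
Proof.
move=> pA; have [hA _] := pA; rewrite mxpowE // -[RHS]spd_eigv //.
by apply: eq_spd => i; rewrite pw1 // eigv_ge0.
Qed.

Lemma adj_mxpow A p : A \is hermsymmx -> adjmx (mxpow A p) = mxpow A p.
Proof. by move=> hA; rewrite mxpowE // adj_spd // spectral_unitarymx. Qed.

(** [mxpow B 0] is the support projection of [B]. The kernel inclusion makes [A] kill its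
    complement, and every power of [A] factors as [mxpow A (p - 1) *m A]. *)
Lemma mxpow_support A B p : psdmx A -> psdmx B -> ker_sub B A ->
  mxpow A p *m mxpow B 0 = mxpow A p.
Proof.
move=> pA pB kBA; have [hA _] := pA; have [hB _] := pB.
have AB : A *m (1%:M - mxpow B 0) = 0.
  apply/matrixP => i j.
  have : B *m (1%:M - mxpow B 0) = 0.
    by rewrite mulmxBr mulmx1 -{2}(mxpow1 pB) mxpowD // addr0 mxpow1 // subrr.
  move=> /(congr1 (col j)); rewrite !colE mul0mx -mulmxA => /kBA.
  by rewrite mulmxA -colE => /colP /(_ i); rewrite !mxE.
apply/esym/eqP; rewrite -subr_eq0 -[X in X - _]mulmx1 -mulmxBr.
by rewrite -[p](subrK 1) -mxpowD // mxpow1 // -mulmxA AB mulmx0.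
Qed.

End Powers.

(** * Limits of difference quotients of exp and ln along a filter *)

Section Limits.
Variables (R : realType) (T : Type) (F : set_system T).
Context {FF : Filter F}.
Implicit Types (d e p u : T -> R).

Lemma cvg_near (f g : T -> R) (l : R) : f @ F --> l ->
  (\forall t \near F, f t = g t) -> g @ F --> l.
Proof. by move=> fl fg; apply: cvg_trans fl; exact: near_eq_cvg. Qed.

Lemma cvg_eventually_le (f : T -> R) (l c : R) : f @ F --> l -> l < c ->
  \forall t \near F, f t <= c.
Proof. by move=> fl lc; apply: filterS (cvgr_lt l fl c lc) => t /ltW. Qed.

Lemma cvg_sum (I : finType) (f : I -> T -> R) (l : I -> R) :
  (forall i, f i t @[t --> F] --> l i) ->
  (\sum_i f i t) @[t --> F] --> \sum_i l i.
Proof. by move=> fl; apply: cvg_big => //; exact: add_continuous. Qed.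

Lemma cvg_dnbhs e : e @ F --> (0 : R) -> (\forall t \near F, e t != 0) ->
  e @ F --> (0 : R)^'.
Proof.
move=> e0 en0 A; rewrite /dnbhs /within /= => /e0 H.
by apply: filterS2 H en0 => t /=; apply.
Qed.

Lemma cvg_expR_slope (k : R) e : e @ F --> (0 : R) ->
  (\forall t \near F, e t != 0) ->
  ((expR (k * e t) - 1) / e t) @[t --> F] --> k.
Proof.
(* The case [k = 0] is separate because [k * e t] must avoid 0 to enter the punctured
   neighbourhood. *)
move=> e0 en0; have [->|k0] := eqVneq k 0.
  apply: (cvg_near (cvg_cst 0)); near=> t.
  by rewrite mul0r expR0 subrr mul0r.
have slope : (h^-1 * (expR h - 1)) @[h --> (0 : R)^'] --> (1 : R).
  pose f h : R := h^-1 *: ((expR \o shift 0) (h *: 1) - expR (0 : R)).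
  have fE : (fun h => h^-1 * (expR h - 1)) = f.
    by apply/funext => h; rewrite /f /= addr0 expR0 [h *: _]mulr1.
  have cf : cvg (f @ 0^') by exact: (ex_derive (is_derive := is_derive_expR 0)).
  have lf : lim (f @ 0^') = 1.
    by rewrite -(expR0 R); exact: (derive_val (is_derive := is_derive_expR 0)).
  by rewrite fE -lf.
have ke : (k * e t) @[t --> F] --> (0 : R)^'.
  apply: cvg_dnbhs; first by rewrite -[0](mulr0 k); exact: cvgMl_tmp.
  by apply: filterS en0 => t et; rewrite mulf_neq0.
rewrite -[X in _ --> X]mul1r.
apply: (cvg_near (cvgM (cvg_comp _ _ ke slope) (cvg_cst k))); apply: filterS en0 => t et /=.
by field; rewrite et k0.
Unshelve. all: by end_near. Qed.

Lemma pw_cvg (r : R) p (p0 : R) : p @ F --> p0 -> pw r (p t) @[t --> F] --> pw r p0.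
Proof.
move=> pp; rewrite /pw; case: eqP => _; first exact: cvg_cst.
apply: (continuous_cvg _ (h := expR)); first exact: continuous_expR.
exact: cvgMr_tmp.
Qed.

(** Since [u] may vanish, the quotient of [ln (1 + u)] by [u] is avoided. Applying [ln (1 + x) <= x]
    to [u] and to the inverse of [1 + u] gives an error of at most [2 u^2] once [|u| < 1/2]. *)
Lemma cvg_ln_slope d u (D : R) : d @ F --> (0 : R) ->
  (\forall t \near F, d t != 0) -> (u t / d t) @[t --> F] --> D ->
  (ln (1 + u t) / d t) @[t --> F] --> D.
Proof.
move=> d0 dn0 uD.
have u0 : u @ F --> (0 : R).
  rewrite -[0](mulr0 D); apply: (cvg_near (cvgM uD d0)).
  by apply: filterS dn0 => t dt /=; rewrite divfK.
have bnd : (2 * `|u t / d t| * `|u t|) @[t --> F] --> (0 : R).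
  rewrite -[X in _ --> X](mulr0 (2 * `|D|)) -(normr0 R).
  by apply: cvgM; [apply: cvgMl_tmp; exact: cvg_norm | exact: cvg_norm].
have diff : (ln (1 + u t) / d t - u t / d t) @[t --> F] --> (0 : R).
  apply: (@squeeze_cvgr _ _ _ _ (fun t => - (2 * `|u t / d t| * `|u t|))
    (fun t => 2 * `|u t / d t| * `|u t|)); last exact: bnd; last first.
    by rewrite -oppr0; exact: cvgN.
  near=> t; rewrite -ler_norml -mulrBl.
  have ut : `|u t| < 2^-1.
    by near: t; apply: (cvgr0_norm_lt _ u0); rewrite invr_gt0.
  have /andP[u1 u2] : - 2^-1 < u t < 2^-1 by rewrite -ltr_norml.
  have pos : 0 < 1 + u t by lra.
  have l1 : ln (1 + u t) <= u t by apply: le_ln1Dx; lra.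
  have l2 : - ln (1 + u t) <= (1 + u t)^-1 - 1.
    rewrite -lnV ?posrE // -[X in ln X](subrKC 1); apply: le_ln1Dx.
    by have := pos; rewrite -invr_gt0 => ?; lra.
  have l3 : `|ln (1 + u t) - u t| <= 2 * `|u t| * `|u t|.
    have sq : 0 <= u t * u t by rewrite -expr2 sqr_ge0.
    rewrite ler0_norm ?subr_le0 // opprB -mulrA -normrM (ger0_norm sq).
    apply: (le_trans (y := u t + ((1 + u t)^-1 - 1))); first by lra.
    rewrite (_ : u t + _ = (u t * u t) / (1 + u t)); last first.
      by field; rewrite gt_eqF.
    by rewrite ler_pdivrMr //; nra.
  by rewrite !normrM mulrA [leRHS]mulrAC ler_wpM2r //.
rewrite -[X in _ --> X]add0r; apply: (cvg_near (cvgD diff uD)).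
by near=> t => /=; rewrite subrK.
Unshelve. all: by end_near. Qed.

End Limits.

(** * Second-order Taylor bound for real powers, uniform in the exponent *)

Section PowerTaylor.
Variable R : realType.
Implicit Types (a b c m M p q x y z Z : R).

Lemma pw_powR x p : x != 0 -> pw x p = x `^ p.
Proof. by rewrite /pw /powR => /negbTE ->. Qed.

Lemma pw_mvt p x y : 0 < x -> 0 < y -> exists2 c,
  Num.min x y <= c <= Num.max x y & pw y p - pw x p = p * pw c (p - 1) * (y - x).
Proof.
wlog xy : x y / x <= y => [hw x0 y0|x0 y0].
  have [xy|/ltW yx] := leP x y.
    by have := hw _ _ xy x0 y0; rewrite (min_idPl xy) (max_idPr xy).
  have [c] := hw _ _ yx y0 x0; rewrite (min_idPl yx) (max_idPr yx) => cyx e.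
  by exists c => //; rewrite -opprB e -mulrN opprB.
have pos c : x <= c -> 0 < c by apply: lt_le_trans.
have [c|t|c] := @MVT_segment R (fun t => t `^ p) (fun t => p * t `^ (p - 1)) _ _ xy.
- rewrite in_itv /= => /andP[/ltW /pos c0 _]; exact: is_derive1_powR.
- apply: derivable_within_continuous => c; rewrite in_itv /= => /andP[/pos c0 _].
  exact: (ex_derive (is_derive := is_derive1_powR p c0)).
- rewrite in_itv /= => /andP[xc cy] e; exists c.
    by rewrite (min_idPl xy) (max_idPr xy) xc.
  by rewrite !pw_powR ?gt_eqF // (pos _ xc).
Qed.

Lemma pw_le m M Z x p : 0 < m -> m <= x <= M -> `|p| <= Z ->
  pw x p <= expR (Z * (`|ln m| + `|ln M|)).
Proof.
move=> m0 /andP[mx xM] pZ; have x0 : 0 < x by apply: lt_le_trans mx.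
rewrite /pw gt_eqF // ler_expR (le_trans (ler_norm _)) // normrM ler_pM //.
have l1 : ln m <= ln x by rewrite ler_ln ?posrE.
have l2 : ln x <= ln M by rewrite ler_ln ?posrE // (lt_le_trans x0).
have := ler_norm (ln M); have := ler_norm (- ln m); rewrite normrN => h1 h2.
have := normr_ge0 (ln M); have := normr_ge0 (ln m) => h3 h4.
by rewrite ler_norml; apply/andP; split; lra.
Qed.

(** Away from 0 the mean value theorem is used twice. If exactly one of [a], [b] is 0, then
    [|b - a| >= m], and the jump of [pw] at 0 is absorbed by the quadratic term. *)
Lemma pw_taylor2 m M Z : 0 < m -> exists K, forall z a b, `|z| <= Z ->
  (a == 0) || (m <= a <= M) -> (b == 0) || (m <= b <= M) ->
  `|pw b z - pw a z - (b - a) * (z * pw a (z - 1))| <= K * (b - a) ^+ 2.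
Proof.
move=> m0; set E := expR ((Z + 2) * (`|ln m| + `|ln M|)).
have E0 : 0 <= E by exact: expR_ge0.
(* The first summand bounds the second derivative, whose exponent [z - 2] explains the [Z + 2] in
   [E]. The second summand pays for the jump at 0. *)
exists (Z * (Z + 1) * E + (Z + 1) * E / m ^+ 2) => z a b zZ ha hb.
have Z0 : 0 <= Z by apply: le_trans zZ.
have bnd x p : m <= x <= M -> `|p| <= Z + 2 -> pw x p <= E by exact: pw_le.
have z1 : `|z - 1| <= Z + 1.
  by rewrite (le_trans (ler_normB _ _)) // normr1 lerD2r.
have zZ2 : `|z| <= Z + 2 by lra.
have far x : m <= x <= M -> (Z + 1) * E <=
    (Z * (Z + 1) * E + (Z + 1) * E / m ^+ 2) * x ^+ 2.
  move=> /andP[mx _]; rewrite [leRHS]mulrDl; apply: ler_wpDl.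
    by rewrite !mulr_ge0 ?sqr_ge0 //; lra.
  rewrite -[leLHS]mulr1 -[leRHS]mulrA; apply: ler_wpM2l.
    by rewrite mulr_ge0 //; lra.
  by rewrite mulrC -expr_div_n exprn_ege1 // ler_pdivlMr // mul1r.
have pw0 p : pw 0 p = 0 by rewrite /pw eqxx.
case/orP: ha => [/eqP ->|ha]; case/orP: hb => [/eqP ->|hb].
- by rewrite !pw0 !subrr mul0r subrr normr0 expr0n mulr0.
- rewrite !pw0 !subr0 !mulr0 subr0 (le_trans _ (far _ hb)) //.
  rewrite ger0_norm; last by rewrite /pw; case: ifP; rewrite ?expR_ge0.
  by rewrite (le_trans (bnd _ _ hb zZ2)) // ler_peMl //; lra.
- have am : a != 0 by rewrite gt_eqF //; case/andP: ha => /(lt_le_trans m0).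
  rewrite pw0 !sub0r sqrrN (le_trans _ (far _ ha)) //.
  have -> : - pw a z - - a * (z * pw a (z - 1)) = (z - 1) * pw a z.
    have {2}-> : a = pw a 1.
      by rewrite pw1 //; case/andP: ha => /(lt_le_trans m0)/ltW.
    rewrite mulNr opprK mulrCA pwD subrKC.
    by rewrite mulrBl mul1r addrC.
  rewrite normrM ler_pM // ger0_norm ?bnd //.
  by rewrite /pw; case: ifP; rewrite ?expR_ge0.
have a0 : 0 < a by case/andP: ha => /(lt_le_trans m0).
have b0 : 0 < b by case/andP: hb => /(lt_le_trans m0).
have [c cab ->] := pw_mvt z a0 b0.
have hc : m <= c <= M.
  case/andP: cab ha hb => c1 c2 /andP[? ?] /andP[? ?]; apply/andP; split.
    by apply: le_trans c1; rewrite le_min; apply/andP.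
  by apply: le_trans c2 _; rewrite ge_max; apply/andP.
have c0 : 0 < c by case/andP: hc => /(lt_le_trans m0).
have ca : `|c - a| <= `|b - a|.
  case/andP: cab => c1 c2; have [ab|/ltW ba] := leP a b.
    move: c1 c2; rewrite (min_idPl ab) (max_idPr ab) => c1 c2.
    by rewrite !ger0_norm ?subr_ge0 // lerB.
  move: c1 c2; rewrite (min_idPr ba) (max_idPl ba) => c1 c2.
  by rewrite !ler0_norm ?subr_le0 // lerN2 lerB.
rewrite (_ : _ - _ = z * (b - a) * (pw c (z - 1) - pw a (z - 1))); last by ring.
have [d dac ->] := pw_mvt (z - 1) a0 c0.
have hd : m <= d <= M.
  case/andP: dac ha hc => c1 c2 /andP[? ?] /andP[? ?]; apply/andP; split.
    by apply: le_trans c1; rewrite le_min; apply/andP.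
  by apply: le_trans c2 _; rewrite ge_max; apply/andP.
have dE : `|pw d (z - 1 - 1)| <= E.
  rewrite ger0_norm; last by rewrite /pw; case: ifP; rewrite ?expR_ge0.
  apply: bnd => //; rewrite (le_trans (ler_normB _ _)) // normr1; lra.
rewrite !normrM [leRHS]mulrDl ler_wpDr //.
  by rewrite mulr_ge0 ?sqr_ge0 // mulr_ge0 ?invr_ge0 ?sqr_ge0 // mulr_ge0 //; lra.
have -> : Z * (Z + 1) * E * (b - a) ^+ 2 =
    (Z * `|b - a|) * ((Z + 1) * E * `|b - a|).
  by rewrite -real_normK ?num_real //; ring.
by rewrite !ler_pM // ?mulr_ge0.
Qed.

End PowerTaylor.

(** * Absorbing support projections in traces *)

Section SupportAbsorption.
Variables (R : realType) (n : nat) (S X Y : 'M[R[i]]_n).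
Hypotheses (XS : X *m S = X) (YS : Y *m S = Y).

(** In the applications [X] and [Y] are powers of [rho], [S] is the support projection of [sigma]
    and [L] is a logarithm. This lemma and the next three cover the four positions of the logarithm
    in a fourfold trace. *)
Lemma retr_absorb13 L : retr (L *m X *m S *m Y *m S) = retr (L *m (X *m Y)).
Proof. by rewrite -(mulmxA L X) XS -(mulmxA _ Y S) YS mulmxA. Qed.

Lemma retr_absorb4 L : retr (X *m L *m Y *m S) = retr (L *m (Y *m X)).
Proof. by rewrite -(mulmxA _ Y S) YS -mulmxA retrC mulmxA. Qed.

Lemma retr_absorb24 L : retr (X *m S *m (L *m Y) *m S) = retr (L *m (Y *m X)).
Proof. by rewrite XS -(mulmxA X) -(mulmxA L) YS retrC -mulmxA. Qed.

Lemma retr_absorb2 L : retr (X *m S *m Y *m L) = retr (L *m (X *m Y)).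
Proof. by rewrite XS retrC. Qed.

End SupportAbsorption.

(** * Continuity and first-order expansion of fourfold traces *)

Section FourfoldTrace.
Variables (R : realType) (n : nat) (rho sigma : 'M[R[i]]_n).
Hypotheses (rho_psd : psdmx rho) (sigma_psd : psdmx sigma).
Hypothesis ker_sigma : ker_sub sigma rho.

Let rhoH : rho \is hermsymmx := rho_psd.1.
Let sigmaH : sigma \is hermsymmx := sigma_psd.1.

Definition trace4 (p q p' q' : R) : R :=
  retr (mxpow rho p *m mxpow sigma q *m mxpow rho p' *m mxpow sigma q').

Lemma mxpow_supportr p : mxpow rho p *m mxpow sigma 0 = mxpow rho p.
Proof. exact: mxpow_support. Qed.

Lemma trace4_0 p p' : trace4 p 0 p' 0 = retr (mxpow rho (p + p')).
Proof. by rewrite /trace4 mxpow_supportr mxpowD // mxpow_supportr. Qed.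

Let r := eigv rho.
Let s := eigv sigma.
Let c := ovl4 (spectralmx rho) (spectralmx sigma).

Lemma trace4E p q p' q' : trace4 p q p' q' = \sum_i \sum_j \sum_k \sum_l
  pw (r i) p * pw (s j) q * pw (r k) p' * pw (s l) q' * c i j k l.
Proof. by rewrite /trace4 !mxpowE // retr_ovl4. Qed.

Variables (T : Type) (F : set_system T).
Context {FF : Filter F}.
Implicit Types (p q e w : T -> R).

Lemma trace4_cvg p q p' q' (p0 q0 p0' q0' : R) :
  p @ F --> p0 -> q @ F --> q0 -> p' @ F --> p0' -> q' @ F --> q0' ->
  trace4 (p t) (q t) (p' t) (q' t) @[t --> F] --> trace4 p0 q0 p0' q0'.
Proof.
move=> hp hq hp' hq'; rewrite trace4E; under eq_fun do rewrite trace4E.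
do 4 (apply: cvg_sum => ?); apply: cvgM; last exact: cvg_cst.
by do 3 (apply: cvgM; last exact: pw_cvg); exact: pw_cvg.
Qed.

Let lg (x : R) := if x == 0 then 0 else ln x.

Lemma mxlogM_pow (p : R) : mxlog rho *m mxpow rho p =
  spd (spectralmx rho) (fun i => pw (r i) p * lg (r i)).
Proof.
rewrite mxpowE // /mxlog supp_funE // spdM ?spectral_unitarymx //.
by apply: eq_spd => i; rewrite mulrC.
Qed.

(** The factor [pw (s i) 0] is 1 on the support and 0 off it, where [lg] vanishes anyway. It gives
    the logarithm the shape of the terms in a slope sum. *)
Lemma mxlogE : mxlog sigma = spd (spectralmx sigma) (fun i => pw (s i) 0 * lg (s i)).
Proof.
rewrite /mxlog supp_funE //; apply: eq_spd => i; rewrite /pw /lg -/(s i).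
by case: eqP => _; rewrite ?mulr0 // mul0r expR0 mul1r.
Qed.

(** At [w = 1], this trace and the next are the two halves of the relative entropy. *)
Definition tr_log (w : R) := retr (mxlog rho *m mxpow rho w).
Definition tr_xlog (w : R) := retr (mxlog sigma *m mxpow rho w).

(** Each of the four logarithms yields one fourfold trace, in which the other [sigma] factors are
    support projections. Absorbing these leaves a trace that depends on [w] and [w'] only through
    their sum. *)
Lemma trace4_slope_value (w w' a b a' b' : R) :
  \sum_i \sum_j \sum_k \sum_l
    pw (r i) w * pw (s j) 0 * pw (r k) w' * pw (s l) 0 *
    (a * lg (r i) + b * lg (s j) + a' * lg (r k) + b' * lg (s l)) * c i j k l =
  (a + a') * tr_log (w + w') + (b + b') * tr_xlog (w + w').
Proof.
pose S4 x y x' y' := retr (spd (spectralmx rho) x *m spd (spectralmx sigma) y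
  *m spd (spectralmx rho) x' *m spd (spectralmx sigma) y').
have S4E x y x' y' : S4 x y x' y' =
    \sum_i \sum_j \sum_k \sum_l x i * y j * x' k * y' l * c i j k l.
  exact: retr_ovl4.
have e1 : tr_log (w + w') = S4 (fun i => pw (r i) w * lg (r i))
    (fun j => pw (s j) 0) (fun k => pw (r k) w') (fun l => pw (s l) 0).
  rewrite /S4 -mxlogM_pow -(mxpowE 0 sigmaH) -(mxpowE w' rhoH).
  rewrite /tr_log -(mxpowD w w' rhoH).
  exact/esym/(retr_absorb13 (mxpow_supportr w) (mxpow_supportr w')).
have e2 : tr_xlog (w + w') = S4 (fun i => pw (r i) w)
    (fun j => pw (s j) 0 * lg (s j)) (fun k => pw (r k) w') (fun l => pw (s l) 0).
  rewrite /S4 -mxlogE -(mxpowE 0 sigmaH) -(mxpowE w rhoH) -(mxpowE w' rhoH).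
  rewrite /tr_xlog (addrC w) -(mxpowD w' w rhoH).
  exact/esym/(retr_absorb4 _ (mxpow_supportr w')).
have e3 : tr_log (w + w') = S4 (fun i => pw (r i) w)
    (fun j => pw (s j) 0) (fun k => pw (r k) w' * lg (r k)) (fun l => pw (s l) 0).
  rewrite /S4 -mxlogM_pow -(mxpowE 0 sigmaH) -(mxpowE w rhoH).
  rewrite /tr_log (addrC w) -(mxpowD w' w rhoH).
  exact/esym/(retr_absorb24 (mxpow_supportr w) (mxpow_supportr w')).
have e4 : tr_xlog (w + w') = S4 (fun i => pw (r i) w)
    (fun j => pw (s j) 0) (fun k => pw (r k) w') (fun l => pw (s l) 0 * lg (s l)).
  rewrite /S4 -mxlogE -(mxpowE 0 sigmaH) -(mxpowE w rhoH) -(mxpowE w' rhoH).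
  rewrite /tr_xlog -(mxpowD w w' rhoH).
  exact/esym/(retr_absorb2 _ (mxpow_supportr w)).
rewrite 2!mulrDl {1}e1 e3 {1}e2 e4 !S4E !mulr_sumr -!big_split.
apply: eq_bigr => i _; rewrite !mulr_sumr -!big_split.
apply: eq_bigr => j _; rewrite !mulr_sumr -!big_split.
apply: eq_bigr => k _; rewrite !mulr_sumr -!big_split.
by apply: eq_bigr => l _; rewrite /= -/c -/r -/s; ring.
Qed.

(** The increment is taken in [e] alone: each term of the expansion contains the factor
    [(expR (k * e) - 1) / e] with [k] constant. The base exponents [w] and [w'] may therefore move
    with [t]. *)
Lemma trace4_slope e w w' (w0 w0' a b a' b' : R) :
  e @ F --> (0 : R) -> (\forall t \near F, e t != 0) ->
  w @ F --> w0 -> w' @ F --> w0' ->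
  ((trace4 (w t + a * e t) (b * e t) (w' t + a' * e t) (b' * e t)
     - retr (mxpow rho (w t + w' t))) / e t) @[t --> F] -->
  (a + a') * tr_log (w0 + w0') + (b + b') * tr_xlog (w0 + w0').
Proof.
move=> e0 en0 ww ww'; rewrite -trace4_slope_value.
have H : (\sum_i \sum_j \sum_k \sum_l
   pw (r i) (w t) * pw (s j) 0 * pw (r k) (w' t) * pw (s l) 0 *
   ((expR ((a * lg (r i) + b * lg (s j) + a' * lg (r k) + b' * lg (s l)) * e t)
     - 1) / e t) * c i j k l) @[t --> F] -->
  \sum_i \sum_j \sum_k \sum_l
    pw (r i) w0 * pw (s j) 0 * pw (r k) w0' * pw (s l) 0 *
    (a * lg (r i) + b * lg (s j) + a' * lg (r k) + b' * lg (s l)) * c i j k l.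
  do 4 (apply: cvg_sum => ?); apply: cvgM; last exact: cvg_cst.
  apply: cvgM; last exact: cvg_expR_slope.
  apply: cvgM; last exact: cvg_cst.
  apply: cvgM; last exact: pw_cvg.
  by apply: cvgM; [exact: pw_cvg | exact: cvg_cst].
apply: (cvg_near H); apply: filterS en0 => t et.
rewrite -trace4_0 !trace4E; do 4 (rewrite -sumrB mulr_suml; apply: eq_bigr => ? _).
rewrite -mulrBl [RHS]mulrAC; congr (_ * _); rewrite mulrA; congr (_ * _).
(* A zero eigenvalue kills both sides; otherwise all powers are exponentials and their exponents
   add. *)
rewrite /pw /lg; do 4 (case: eqP => _; first by rewrite !(mulr0, mul0r) subrr).
rewrite mulrBr mulr1 -!expRD; congr (expR _ - expR _); ring.
Qed.

End FourfoldTrace.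

(** * Algebra of sandwiched products *)

Section SandwichTraces.
Variables (R : realType) (n : nat) (X Y Z S S2 : 'M[R[i]]_n).

Lemma adj_sandwich : adjmx S = S -> adjmx X = X ->
  adjmx (S *m X *m S) = S *m X *m S.
Proof. by move=> aS aX; rewrite 2!adjmxM aS aX mulmxA. Qed.

Lemma gram_sandwich : adjmx S = S -> adjmx X = X -> X *m X = Y ->
  S *m Y *m S = adjmx (X *m S) *m (X *m S).
Proof. by move=> aS aX <-; rewrite adjmxM aS aX !mulmxA. Qed.

Lemma retr_gram S0 : adjmx S = S -> adjmx X = X -> S *m S = S2 ->
  X *m S0 = X ->
  retr ((X *m S) *m adjmx (X *m S)) = retr (X *m S2 *m X *m S0).
Proof.
by move=> aS aX <- h; rewrite -(mulmxA _ X S0) h adjmxM aS aX !mulmxA.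
Qed.

(** This supplies the relation [K B = N] of the eigenvalue bounds. [Si] inverts [S] only up to the
    support projection [S0], which [Xi] absorbs. *)
Lemma sandwich_cancel Xi Si S0 : Xi *m S0 = Xi -> Xi *m Y = X ->
  Si *m S = S0 -> (Xi *m Si) *m (S *m Y *m S) = X *m S.
Proof.
by move=> h1 h2 h3; rewrite !mulmxA -(mulmxA Xi Si S) h3 h1 h2.
Qed.

(** The zeroth powers [X0] and [S0] pad a trace of three factors to the fourfold form. *)
Lemma retr_sandwich X0 S0 : S *m S = S2 -> X0 *m S0 = X0 -> X0 *m X = X ->
  retr (S *m X *m S) = retr (X *m S2 *m X0 *m S0).
Proof.
move=> <- h1 h2; rewrite -(mulmxA _ X0 S0) h1 [RHS]retrC (mulmxA X0) h2.
by rewrite -(mulmxA S) retrC mulmxA.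
Qed.

Lemma sandwich_sq : S *m S = S2 ->
  retr ((S *m X *m S) *m (S *m X *m S)) = retr (X *m S2 *m X *m S2).
Proof.
by move=> <-; rewrite -(mulmxA S X) -(mulmxA S) retrC !mulmxA.
Qed.

Lemma sandwich_mul W : retr ((S *m X *m S) *m W) = retr (X *m S *m W *m S).
Proof. by rewrite -(mulmxA S X) -(mulmxA S) retrC. Qed.

Lemma retr_sandwich_sub Z2 : Z *m Y = Z2 ->
  retr ((S *m X *m S - Z) *m Y) = retr (X *m S *m Y *m S) - retr Z2.
Proof. by move=> <-; rewrite mulmxBl retrB sandwich_mul. Qed.

Lemma retr_sandwich_sub_sq Z2 : S *m S = S2 -> Z *m Z = Z2 ->
  retr ((S *m X *m S - Z) *m (S *m X *m S - Z)) =
  retr (X *m S2 *m X *m S2) - 2 * retr (X *m S *m Z *m S) + retr Z2.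
Proof.
move=> hS <-; rewrite mulmxBl 2!mulmxBr 3!retrB (retrC Z) (sandwich_sq hS).
rewrite -(sandwich_mul Z); ring.
Qed.

End SandwichTraces.

(** * Trace of a power of the sandwiched operator *)

Section TracePower.
Variables (R : realType) (n : nat) (rho sigma : 'M[R[i]]_n).
Hypotheses (rho_psd : psdmx rho) (sigma_psd : psdmx sigma).
Hypothesis ker_sigma : ker_sub sigma rho.

Let rhoH : rho \is hermsymmx := rho_psd.1.
Let sigmaH : sigma \is hermsymmx := sigma_psd.1.
Local Notation tr4 := (trace4 rho sigma).

Definition sandwich (p e : R) := mxpow sigma e *m mxpow rho p *m mxpow sigma e.

Lemma sandwich_herm p e : sandwich p e \is hermsymmx.
Proof. by rewrite hermsymmxE adj_sandwich ?adj_mxpow. Qed.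

Lemma sandwich_gram p e : sandwich (p + p) e =
  adjmx (mxpow rho p *m mxpow sigma e) *m (mxpow rho p *m mxpow sigma e).
Proof.
exact: (gram_sandwich (adj_mxpow e sigmaH) (adj_mxpow p rhoH) (mxpowD p p rhoH)).
Qed.

(** The exponent [p + p] splits evenly, making the operator a Gram matrix. The bounds are fourfold
    traces, hence continuous in the exponents, which makes them uniform near the limit. *)
Lemma sandwich_eigv p e i : let b := eigv (sandwich (p + p) e) i in
  [/\ 0 <= b, b <= tr4 (p + p) (2 * e) 0 0 &
      b != 0 -> 1 <= b * tr4 (- p) (- 2 * e) (- p) 0].
Proof.
set B := sandwich _ _; set N := mxpow rho p *m mxpow sigma e.
set K := mxpow rho (- p) *m mxpow sigma (- e).
have hB : B \is hermsymmx by exact: sandwich_herm.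
have BN : spd (spectralmx B) (eigv B) = adjmx N *m N.
  by rewrite spd_eigv // -sandwich_gram.
have KB : K *m spd (spectralmx B) (eigv B) = N.
  rewrite spd_eigv //; apply: (sandwich_cancel (S0 := mxpow sigma 0)).
  - exact: mxpow_supportr.
  - by rewrite (mxpowD _ _ rhoH) addKr.
  - by rewrite (mxpowD _ _ sigmaH) addNr.
have [b0 bM bm] := gram_eigenvalue_bounds (spectral_unitarymx B) BN KB i.
have tN : retr (adjmx N *m N) = tr4 (p + p) (2 * e) 0 0.
  rewrite -sandwich_gram; apply: retr_sandwich.
  - by rewrite (mxpowD _ _ sigmaH) mulr_natl mulr2n.
  - exact: mxpow_supportr.
  - by rewrite (mxpowD _ _ rhoH) add0r.
have tK : retr (K *m adjmx K) = tr4 (- p) (- 2 * e) (- p) 0.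
  have S2 : mxpow sigma (- e) *m mxpow sigma (- e) = mxpow sigma (- 2 * e).
    by rewrite (mxpowD _ _ sigmaH) -opprD mulNr mulr_natl mulr2n.
  apply: (retr_gram (adj_mxpow (- e) sigmaH) (adj_mxpow (- p) rhoH) S2).
  exact: mxpow_supportr.
by rewrite -tN -tK.
Qed.

(** For the base point, the reciprocal of a nonzero [a] is the same eigenvalue raised to [- w],
    hence at most the trace of [mxpow rho (- w)]. *)
Lemma pw_eigv_bounds w i : let a := pw (eigv rho i) w in
  [/\ 0 <= a, a <= retr (mxpow rho w) & a != 0 -> 1 <= a * retr (mxpow rho (- w))].
Proof.
have pw_ge0 p j : 0 <= pw (eigv rho j) p.
  by rewrite /pw; case: ifP; rewrite ?expR_ge0.
have le_tr p : pw (eigv rho i) p <= retr (mxpow rho p).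
  rewrite mxpowE // retr_spd ?spectral_unitarymx // (bigD1 i) //= lerDl.
  exact: sumr_ge0.
split=> // a0.
have <- : pw (eigv rho i) w * pw (eigv rho i) (- w) = 1.
  rewrite pwD subrr; move: a0; rewrite /pw.
  by case: (eigv rho i == 0); rewrite ?eqxx // mul0r expR0.
exact: ler_wpM2l.
Qed.

(* [rho^w] is chosen as base point because [(rho^w)^z = rho] when [w z = 1]. *)
Lemma trace_power_expansion m M C z w e :
  (forall a b, (a == 0) || (m <= a <= M) -> (b == 0) || (m <= b <= M) ->
    `|pw b z - pw a z - (b - a) * (z * pw a (z - 1))| <= C * (b - a) ^+ 2) ->
  0 < m -> w * z = 1 ->
  tr4 (w - 2 * e) (2 * e) 0 0 <= M -> retr (mxpow rho w) <= M ->
  tr4 (- (w - 2 * e) / 2) (- 2 * e) (- (w - 2 * e) / 2) 0 <= m^-1 ->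
  retr (mxpow rho (- w)) <= m^-1 ->
  `|retr (mxpow (sandwich (w - 2 * e) e) z) - retr rho -
    z * (tr4 (w - 2 * e) e (1 - w) e - retr rho)| <=
  C * (tr4 (w - 2 * e) (2 * e) (w - 2 * e) (2 * e) -
       2 * tr4 (w - 2 * e) e w e + retr (mxpow rho (w + w))).
Proof.
move=> hC m0 wz; set p := w - 2 * e => M1 M2 m1 m2.
have pp : p = p / 2 + p / 2 by field.
set B := sandwich p e.
have hB : B \is hermsymmx by exact: sandwich_herm.
have inv x t : 0 <= x -> (x != 0 -> 1 <= x * t) -> t <= m^-1 ->
    x <= M -> (x == 0) || (m <= x <= M).
  move=> x0 xt tm xM; case: eqP => //= /eqP xn0; rewrite xM andbT.
  have := le_trans (xt xn0) (ler_wpM2l x0 tm).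
  by rewrite ler_pdivlMr // mul1r.
have hb j : (eigv B j == 0) || (m <= eigv B j <= M).
  have [] := sandwich_eigv (p / 2) e j; rewrite -pp -mulNr => b0 bM bm.
  exact: inv b0 bm m1 (le_trans bM M1).
pose a i := pw (eigv rho i) w.
have ha i : (a i == 0) || (m <= a i <= M).
  have [a0 aM am] := pw_eigv_bounds w i.
  by apply: inv a0 am m2 _; exact: le_trans aM M2.
have := klein (spectral_unitarymx rho) (spectral_unitarymx B)
  (fun i j => hC _ _ (ha i) (hb j)).
have -> : spd (spectralmx B) (fun j => pw (eigv B j) z) = mxpow B z.
  by rewrite mxpowE.
have -> : spd (spectralmx rho) (fun i => pw (a i) z) = rho.
  rewrite -[RHS]mxpow1 // mxpowE //; apply: eq_spd => i.
  by rewrite /a pwM wz.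
(* The derivative of the z-th power at [rho^w] is [z (rho^w)^(z-1)], and [w z = 1] turns the
   exponent into [1 - w]. *)
have -> : spd (spectralmx rho) (fun i => z * pw (a i) (z - 1)) =
    z%:C%C *: mxpow rho (1 - w).
  rewrite mxpowE // -spdZ; apply: eq_spd => i; congr (_ * _).
  by rewrite /a pwM mulrBr wz mulr1.
have -> : spd (spectralmx B) (fun j => eigv B j) = B by rewrite spd_eigv.
have -> : spd (spectralmx rho) a = mxpow rho w by rewrite mxpowE.
have -> : retr ((B - mxpow rho w) *m (z%:C%C *: mxpow rho (1 - w))) =
    z * (tr4 p e (1 - w) e - retr rho).
  have rE : mxpow rho w *m mxpow rho (1 - w) = rho.
    by rewrite (mxpowD _ _ rhoH) subrKC (mxpow1 rho_psd).
  by rewrite -scalemxAr retrZ (retr_sandwich_sub _ _ rE).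
have -> // : retr ((B - mxpow rho w) *m (B - mxpow rho w)) =
    tr4 p (2 * e) p (2 * e) - 2 * tr4 p e w e + retr (mxpow rho (w + w)).
  have S2 : mxpow sigma e *m mxpow sigma e = mxpow sigma (2 * e).
    by rewrite (mxpowD _ _ sigmaH) mulr_natl mulr2n.
  exact: (retr_sandwich_sub_sq _ S2 (mxpowD w w rhoH)).
Qed.

End TracePower.

(** * Slope of the trace along the limit *)

Section TraceSlope.
Variables (R : realType) (n : nat) (rho sigma : 'M[R[i]]_n).
Hypotheses (rho_psd : psdmx rho) (sigma_psd : psdmx sigma).
Hypothesis ker_sigma : ker_sub sigma rho.
Local Notation tr4 := (trace4 rho sigma).
Let rhoH : rho \is hermsymmx := rho_psd.1.

Variables (T : Type) (F : set_system T).
Context {FF : Filter F}.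
Variables (e z : T -> R) (z0 : R).
Hypotheses (z0_neq0 : z0 != 0) (zz0 : z @ F --> z0).
Hypotheses (e0 : e @ F --> (0 : R)) (e_neq0 : \forall t \near F, e t != 0).

Let w t := (z t)^-1.
Let w0 := z0^-1.

Let ww0 : w @ F --> w0. Proof. exact: cvgV. Qed.

Let slope a b a' b' w' w0' (H : w' @ F --> w0') :=
  @trace4_slope R n rho sigma rho_psd sigma_psd ker_sigma T F FF
    e w w' w0 w0' a b a' b' e0 e_neq0 ww0 H.

(** The exponents of [rho] have base sum 1 and total increment [- 2 e], those of [sigma] total
    increment [2 e]. *)
Lemma first_order_slope :
  ((tr4 (w t - 2 * e t) (e t) (1 - w t) (e t) - retr rho) / e t) @[t --> F] -->
  - 2 * tr_log rho 1 + 2 * tr_xlog rho sigma 1.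
Proof.
have ww' : (1 - w t) @[t --> F] --> 1 - w0 by apply: cvgB ww0; exact: cvg_cst.
have := @slope (- 2) 1 0 1 _ _ ww'; rewrite subrKC addr0 -[1 + 1]/(2 : R) => H.
apply: (cvg_near H); apply: filterE => t.
by rewrite subrKC (mxpow1 rho_psd) mul0r addr0 mul1r mulNr.
Qed.

(** This is the trace of the square of [B - rho^w]. The constant parts cancel as [1 - 2 + 1], and
    the slope of the first trace is twice that of the second. *)
Lemma second_order_slope :
  ((tr4 (w t - 2 * e t) (2 * e t) (w t - 2 * e t) (2 * e t)
    - 2 * tr4 (w t - 2 * e t) (e t) (w t) (e t) + retr (mxpow rho (w t + w t)))
   / e t) @[t --> F] --> (0 : R).
Proof.
have H1 := @slope (- 2) 2 (- 2) 2 _ _ ww0; have H2 := @slope (- 2) 1 0 1 _ _ ww0.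
have E (L X : R) :
    0 = ((- 2 + - 2) * L + (2 + 2) * X) - 2 * ((- 2 + 0) * L + (1 + 1) * X).
  by ring.
rewrite [X in _ --> X](E (tr_log rho (w0 + w0)) (tr_xlog rho sigma (w0 + w0))).
apply: (cvg_near (cvgB H1 (cvgMl_tmp (a := 2) H2))); apply: filterE => t /=.
rewrite !fctE /= mul0r addr0 mul1r mulNr.
by move: (trace4 _ _ _ _ _ _) (trace4 _ _ _ _ _ _) (retr _) => x y v; ring.
Qed.

Lemma retr_mxpow_cvg p p0 : p @ F --> p0 ->
  retr (mxpow rho (p t)) @[t --> F] --> retr (mxpow rho p0).
Proof.
move=> pp0; have E q : retr (mxpow rho q) = \sum_i pw (eigv rho i) q.
  by rewrite mxpowE // retr_spd ?spectral_unitarymx.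
rewrite [X in _ --> X]E; apply: (@cvg_near _ _ _ _ (fun t => \sum_i pw (eigv rho i) (p t))).
  by apply: cvg_sum => i; exact: pw_cvg.
by apply: filterE => t; rewrite (E (p t)).
Qed.

Lemma trace_sandwich_slope :
  ((retr (mxpow (sandwich rho sigma (w t - 2 * e t) (e t)) (z t)) - retr rho)
    / (- 2 * e t * z t)) @[t --> F] --> tr_log rho 1 - tr_xlog rho sigma 1.
Proof.
have e2 k : (k * e t) @[t --> F] --> (0 : R).
  by rewrite -[X in _ --> X](mulr0 k); exact: cvgMl_tmp.
have wp : (w t - 2 * e t) @[t --> F] --> w0.
  by rewrite -[X in _ --> X]subr0; exact: cvgB.
have wn : (- (w t - 2 * e t) / 2) @[t --> F] --> - w0 / 2.
  by apply: cvgM; [exact: cvgN | exact: cvg_cst].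
have c0 : (fun=> 0) @ F --> (0 : R) by exact: cvg_cst.
pose L1 := tr4 w0 0 0 0; pose L2 := retr (mxpow rho w0).
pose L3 := tr4 (- w0 / 2) 0 (- w0 / 2) 0; pose L4 := retr (mxpow rho (- w0)).
have l1 : tr4 (w t - 2 * e t) (2 * e t) 0 0 @[t --> F] --> L1.
  exact: (trace4_cvg rho_psd sigma_psd wp (e2 2) c0 c0).
have l2 : retr (mxpow rho (w t)) @[t --> F] --> L2 by exact: retr_mxpow_cvg.
have l3 : tr4 (- (w t - 2 * e t) / 2) (- 2 * e t) (- (w t - 2 * e t) / 2) 0
    @[t --> F] --> L3.
  exact: (trace4_cvg rho_psd sigma_psd wn (e2 (- 2)) wn c0).
have l4 : retr (mxpow rho (- w t)) @[t --> F] --> L4.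
  exact: (retr_mxpow_cvg (cvgN ww0)).
(* Positive and strictly above both limits, so the traces eventually stay below it; its inverse
   serves as the positive lower bound [m]. *)
pose bound (x y : R) : R := `|x| + `|y| + 1.
have bl x y : x < bound x y.
  by rewrite /bound; have := ler_norm x; have := normr_ge0 y; lra.
have br x y : y < bound x y.
  by rewrite /bound; have := ler_norm y; have := normr_ge0 x; lra.
have bp x y : 0 < bound x y.
  by rewrite /bound; have := normr_ge0 y; have := normr_ge0 x; lra.
pose M : R := bound L1 L2; pose m : R := (bound L3 L4)^-1.
have m0 : 0 < m by rewrite invr_gt0.
have [K hK] := @pw_taylor2 R m M (`|z0| + 1) m0.
have n1 := cvg_eventually_le l1 (bl L1 L2).
have n2 := cvg_eventually_le l2 (br L1 L2).
have mV : m^-1 = bound L3 L4 by rewrite /m invrK.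
have L3m : L3 < m^-1 by rewrite mV; exact: bl.
have L4m : L4 < m^-1 by rewrite mV; exact: br.
have n3 := cvg_eventually_le l3 L3m.
have n4 := cvg_eventually_le l4 L4m.
have nz : \forall t \near F, `|z t| <= `|z0| + 1.
  by apply: cvg_eventually_le (cvg_norm zz0) _; rewrite ltrDl.
have nz0 : \forall t \near F, z t != 0 by exact: (cvgr_neq0 _ zz0 z0_neq0).
pose G t := (tr4 (w t - 2 * e t) (e t) (1 - w t) (e t) - retr rho) / e t.
pose Q t := (tr4 (w t - 2 * e t) (2 * e t) (w t - 2 * e t) (2 * e t)
    - 2 * tr4 (w t - 2 * e t) (e t) (w t) (e t) + retr (mxpow rho (w t + w t)))
   / e t.
pose h t := retr (mxpow (sandwich rho sigma (w t - 2 * e t) (e t)) (z t)).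
(* Dividing the linear term [z * (G * e)] by [- 2 * e * z] leaves [- G / 2]. The same division of
   the Klein error [K * (Q * e)] gives [b], up to sign. *)
pose f t := (h t - retr rho) / (- 2 * e t * z t) - (- 2^-1) * G t.
pose b t := `|K * Q t * (2 * z t)^-1|.
have b0 : b @ F --> (0 : R).
  rewrite -(normr0 R) -(mul0r (2 * z0)^-1) -(mulr0 K); apply: cvg_norm.
  apply: cvgM; first by apply: cvgMl_tmp; exact: second_order_slope.
  by apply: cvgV; [rewrite mulf_neq0 ?pnatr_eq0 | exact: cvgMl_tmp].
have f0 : f @ F --> (0 : R).
  apply: (@squeeze_cvgr _ _ _ _ (fun t => - b t) b) => //; last first.
    by rewrite -oppr0; exact: cvgN.
  near=> t; rewrite -ler_norml.
  have zt : z t != 0 by near: t; exact: nz0.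
  have et : e t != 0 by near: t; exact: e_neq0.
  have hKt : forall a c, (a == 0) || (m <= a <= M) -> (c == 0) || (m <= c <= M) ->
    `|pw c (z t) - pw a (z t) - (c - a) * (z t * pw a (z t - 1))| <= K * (c - a) ^+ 2.
    by move=> a c; apply: hK; near: t; exact: nz.
  have B : `|h t - retr rho - z t * (G t * e t)| <= K * (Q t * e t).
    rewrite /G /Q !divfK //; apply: (trace_power_expansion rho_psd sigma_psd
      ker_sigma hKt m0 (mulVf zt)).
    - near: t; exact: n1.
    - near: t; exact: n2.
    - near: t; exact: n3.
    - near: t; exact: n4.
  have -> : f t = (h t - retr rho - z t * (G t * e t)) / (- 2 * e t * z t).
    by rewrite /f; move: (h t) (retr rho) (G t) => x y v; field; rewrite zt et.
  have -> : b t = `|K * (Q t * e t)| / `|- 2 * e t * z t|.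
    rewrite /b -normf_div (_ : K * (Q t * e t) / _ = - (K * Q t * (2 * z t)^-1)).
      by rewrite normrN.
    by move: (Q t) => x; field; rewrite zt et.
  by rewrite normf_div ler_wpM2r ?invr_ge0 // (le_trans B) // ler_norm.
have E (L X : R) : L - X = 0 + - 2^-1 * (- 2 * L + 2 * X) by field.
rewrite [X in _ --> X]E.
apply: (cvg_near (cvgD f0 (cvgMl_tmp (a := - 2^-1) first_order_slope))).
by apply: filterE => t; rewrite !fctE /= /f subrK.
Unshelve. all: by end_near. Qed.

End TraceSlope.

(** * From the trace slope to the entropy *)

Section DazLimit.
Variables (R : realType) (n : nat) (rho sigma : 'M[R[i]]_n).
Hypothesis rho_psd : psdmx rho.

Lemma Daz_sandwich (al z : R) : z != 0 ->
  let e := (1 - al) / (2 * z) in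
  Daz rho sigma al z =
  ln (retr (mxpow (sandwich rho sigma (z^-1 - 2 * e) e) z)) / (al - 1).
Proof.
move=> z0 e; have -> : z^-1 - 2 * e = al / z by rewrite /e; field.
by [].
Qed.

Lemma Drel_tr : Drel rho sigma = tr_log rho 1 - tr_xlog rho sigma 1.
Proof.
have tr_comm (A B C : 'M[R[i]]_n) :
    retr (A *m (B - C)) = retr (B *m A) - retr (C *m A).
  by rewrite mulmxBr retrB (retrC A B) (retrC A C).
by rewrite /tr_log /tr_xlog (mxpow1 rho_psd) -tr_comm.
Qed.

End DazLimit.

(* J = ]a, b[ with a, b extended reals (open interval, possibly unbounded) containing 1 *)
Theorem theorem1 (R : realType) (n : nat) (rho sigma : 'M[R[i]]_n)
    (a b : \bar R) (g : R -> R) :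
  densitymx rho -> psdmx sigma -> ker_sub sigma rho ->
  (a < 1%:E)%E -> (1%:E < b)%E ->
  (forall x : R, (a < x%:E)%E -> (x%:E < b)%E -> derivable g x 1) ->
  (forall x : R, (a < x%:E)%E -> (x%:E < b)%E -> {for x, continuous (g^`())}) ->
  g 1 != 0 ->
  (fun al : R => Daz rho sigma al (g al)) @ (1 : R)^' --> Drel rho sigma.
Proof.
move=> [rho_psd tr_rho] sigma_psd ker_sigma a1 b1 dg _ g1.
have retr1 : retr rho = 1 by rewrite /retr tr_rho.
have gg : g al @[al --> (1 : R)^'] --> g 1.
  apply/continuous_withinNx; apply: differentiable_continuous.
  by apply/derivable1_diffP; exact: dg.
have idc : al @[al --> (1 : R)^'] --> (1 : R).
  by apply/(continuous_withinNx id); exact: cvg_id.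
have gn0 : \forall al \near (1 : R)^', g al != 0 by exact: (cvgr_neq0 _ gg g1).
have aln1 : \forall al \near (1 : R)^', al != 1 by exact: nbhs_dnbhs_neq.
pose e al := (1 - al) / (2 * g al).
have e0 : e @ (1 : R)^' --> (0 : R).
  rewrite -[X in _ --> X](mul0r (2 * g 1)^-1) -(subrr (1 : R)); apply: cvgM.
    by apply: cvgB; [exact: cvg_cst | exact: idc].
  by apply: cvgV; [rewrite mulf_neq0 ?pnatr_eq0 | exact: cvgMl_tmp].
have en0 : \forall al \near (1 : R)^', e al != 0.
  near=> al; rewrite /e mulf_neq0 ?invr_eq0 ?mulf_neq0 ?pnatr_eq0 //.
    by rewrite subr_eq0 eq_sym; near: al; exact: aln1.
  by near: al; exact: gn0.
rewrite (Drel_tr _ rho_psd).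
(* As [rho] has trace 1, the argument of the logarithm in [Daz] is [1 + u al]. *)
pose u al := retr (mxpow (sandwich rho sigma ((g al)^-1 - 2 * e al) (e al)) (g al)) - 1.
have d0 : (al - 1) @[al --> (1 : R)^'] --> (0 : R).
  by rewrite -(subrr (1 : R)); apply: cvgB; [exact: idc | exact: cvg_cst].
have dn0 : \forall al \near (1 : R)^', al - 1 != 0.
  by apply: filterS aln1 => al; rewrite subr_eq0.
have uD : (u al / (al - 1)) @[al --> (1 : R)^'] -->
    tr_log rho 1 - tr_xlog rho sigma 1.
  apply: (cvg_near (trace_sandwich_slope rho_psd sigma_psd ker_sigma
    g1 gg e0 en0)); near=> al.
  have ga : g al != 0 by near: al; exact: gn0.
  (* By the choice of [e], the denominator [- 2 * e al * g al] equals [al - 1]. *)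
  rewrite retr1 -/(u al); congr (_ / _).
  by rewrite /e; field.
apply: (cvg_near (cvg_ln_slope d0 dn0 uD)); near=> al.
have ga : g al != 0 by near: al; exact: gn0.
by rewrite (Daz_sandwich _ _ _ ga) /u subrKC.
Unshelve. all: by end_near. Qed.
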